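(* Let $0=a_0<a_1<a_2<\cdots$ be the job start times of the two-timeline model, with durations $\Delta_i=a_{i+1}-a_i$, and suppose there is $\gamma\ge 1$ with $\gamma^{-1}\Delta_i\le\Delta_{i+1}\le\gamma\Delta_i$ for all $i\ge 0$. Let $T\ge 1$ be the horizon, and for $k\in\{0,\dots,T-1\}$ let $O_k=\sum_{k'=k+1}^{T-1}\mathbf 1_{\{k'-\tau_{k'}\le k\}}$ be the overlap count. Then for every $k\in\{0,\dots,T-1\}$ with $k\ge a_1$, letting $i$ denote the job index with $a_i\le k<b_i$ (where $b_i=a_{i+1}$), $$O_k\;\le\;\Delta_i+\Delta_{i+1}-1\;\le\;(1+\gamma)\Delta_i\;\le\;\gamma(1+\gamma)\,\tau_k.$$ In particular $O_k\le C_{\mathrm{ov}}\,\tau_k$ with $C_{\mathrm{ov}}=\gamma(1+\gamma)$, and $C_{\mathrm{ov}}\to 2$ as $\gamma\to 1$.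
   Context: Two-timeline model: gradient iterations are indexed by integers $k=0,1,2,\dots$, and one gradient iteration takes one unit of wall-clock time. Curvature jobs $i=0,1,2,\dots$ are run serially: job $i$ runs on $[a_i,b_i]$ with $a_{i+1}=b_i$ and has duration $\Delta_i=b_i-a_i$, where the $a_i$ are integers and $a_0=0$. At an iteration $k$ with $a_i\le k<b_i$ and $i\ge 1$, the curvature in use is the one produced by job $i-1$ (computed at the iterate $x_{a_{i-1}}$), and the delay is $\tau_k=k-a_{i-1}$. *)

(* Defs.v *)
From HB Require Import structures.
From mathcomp Require Import all_boot all_order all_algebra.

Set Implicit Arguments.
Unset Strict Implicit.
Unset Printing Implicit Defensive.

Import Order.TTheory GRing.Theory Num.Theory.

(* Job i starts at iteration a i and ends at b_i = a i.+1, where job i.+1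
   starts. *)
Definition in_job (a : nat -> nat) (i k : nat) : bool := a i <= k < a i.+1.

(* The subtraction is not truncated when a is increasing. *)
Definition duration (a : nat -> nat) (i : nat) : nat := a i.+1 - a i.

(* The curvature used during job i comes from job i.-1, hence from the iterate
   of index a i.-1. No curvature is available during job 0, so tau is left
   unconstrained there. *)
Definition is_delay (a tau : nat -> nat) : Prop :=
  forall i k : nat, 1 <= i -> in_job a i k -> tau k = k - a i.-1.

(* For k >= a 1 only iterations k' with tau k' <= k' occur, so the subtraction
   is not truncated. *)
Definition overlap (tau : nat -> nat) (T k : nat) : nat :=
  \sum_(k.+1 <= k' < T) (k' - tau k' <= k).

Definition C_ov (R : pzRingType) (gamma : R) : R :=
  (gamma * (1 + gamma))%R.

(* Main.v *)
Require Import Defs.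
From HB Require Import structures.
From mathcomp Require Import all_boot all_order all_algebra.
From mathcomp Require Import all_classical all_reals all_analysis.
From mathcomp Require Import zify lra.
Import Order.TTheory GRing.Theory Num.Theory.
Import numFieldNormedType.Exports.
Local Open Scope classical_set_scope.
Local Open Scope ring_scope.

(** An iteration [k'] of job [j] uses the curvature computed at [a j.-1], so it
    overlaps an earlier iteration [k] of job [i] only if
    [a j.-1 <= k < a i.+1], which forces [j <= i.+1] by monotonicity of [a].
    All overlapping iterations thus lie strictly between [k] and [a i.+2], and
    since [a i <= k] there are at most
    [a i.+2 - a i - 1 = duration a i + duration a i.+1 - 1] of them
    ([overlap_le]).  In the other direction, the delay at [k] covers at least
    the whole of job [i.-1] ([duration_le_delay]).  The two ratio bounds on
    consecutive durations then compare job [i.+1] with job [i], and job [i]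
    with job [i.-1]; each comparison costs one factor [gamma]. *)

Lemma sum_ltn_le (m n p : nat) : (\sum_(m <= j < n) (j < p) <= p - m)%N.
Proof.
rewrite -big_mkcond /= sum1_count.
apply: leq_trans (_ : size (iota m (p - m)) <= _)%N; last by rewrite size_iota.
rewrite -size_filter; apply: uniq_leq_size; first by rewrite filter_uniq ?iota_uniq.
by move=> j; rewrite mem_filter !mem_iota; lia.
Qed.

Section Timeline.
Variable a : nat -> nat.
Hypothesis a_incr : forall i : nat, (a i < a i.+1)%N.

Lemma start_le (i j : nat) : (i <= j)%N -> (a i <= a j)%N.
Proof.
by apply: (homo_leq leqnn (fun _ _ _ => @leq_trans _ _ _)) => n; exact: ltnW.
Qed.

Lemma in_job_exists (k : nat) : a 0%N = 0%N -> exists i, in_job a i k.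
Proof.
move=> a0; rewrite /in_job; elim: k => [|k [i /andP[aik kai]]].
  by exists 0%N; rewrite a0 /= -[X in (X < _)%N]a0.
case: (ltnP k.+1 (a i.+1)) => [lt|ge]; first by exists i; rewrite lt leqW.
by exists i.+1; rewrite ge /=; apply: leq_ltn_trans kai _.
Qed.

(** Job 0 is the only one without a delay: past [a 1], there is always a
    previous job to take the curvature from. *)
Lemma in_job_gt0 (i k : nat) : (a 1 <= k)%N -> in_job a i k -> (0 < i)%N.
Proof. by case: i => // a1k /andP[_]; rewrite ltnNge a1k. Qed.

Variable tau : nat -> nat.
Hypothesis tauP : is_delay a tau.
Hypothesis a0 : a 0%N = 0%N.

(** The curvature used two jobs after job [i], or later, comes from an iterate
    that is itself later than all of job [i]. *)
Lemma overlapping_lt (i k k' : nat) : (a 1 <= k)%N -> in_job a i k ->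
  (k < k')%N -> (k' - tau k' <= k)%N -> (k' < a i.+2)%N.
Proof.
move=> a1k /andP[aik kai] kk' le_k.
have [j jk'] := in_job_exists k' a0.
have j_gt0 := in_job_gt0 _ _ (leq_trans a1k (ltnW kk')) jk'.
have tk' := tauP _ _ j_gt0 jk'; move: jk' => /andP[ajk k'aj].
rewrite ltnNge; apply/negP => ge.
have lt : (i.+1 < j)%N.
  by rewrite ltnNge; apply/negP => le; have := start_le j.+1 i.+2 le; lia.
have ai_le : (a i.+1 <= a j.-1)%N by apply: start_le; lia.
have aj_le : (a j.-1 <= a j)%N by apply: start_le; lia.
lia.
Qed.

(** The successor on the left stands for the [- 1] on the right of the bound
    over the reals, where subtraction does not truncate: [k] itself lies in
    [a i, a i.+2) but does not overlap itself. *)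
Lemma overlap_le (T i k : nat) : (a 1 <= k)%N -> in_job a i k ->
  ((overlap tau T k).+1 <= duration a i + duration a i.+1)%N.
Proof.
move=> a1k ik.
have : (overlap tau T k <= a i.+2 - k.+1)%N.
  apply: leq_trans (sum_ltn_le k.+1 T (a i.+2)).
  rewrite /overlap big_nat_cond [X in (_ <= X)%N]big_nat_cond.
  apply: leq_sum => k' /andP[/andP[kk' _] _].
  by case: (boolP (k' - tau k' <= k)%N) => // /(overlapping_lt i k k' a1k ik kk') ->.
move: ik => /andP[aik kai]; have := a_incr i; have := a_incr i.+1.
rewrite /duration; lia.
Qed.

Lemma duration_le_delay (i k : nat) : in_job a i.+1 k ->
  (duration a i <= tau k)%N.
Proof.
move=> ik; rewrite (tauP i.+1 k) //=.
by move: ik => /andP[aik _]; rewrite /duration leq_sub2r.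
Qed.

End Timeline.

Lemma cvg_C_ov (R : realType) : C_ov g @[g --> (1 : R)] --> (2 : R).
Proof.
have -> : (2 : R) = 1 * (1 + 1) by rewrite mul1r.
by apply: cvgM; [exact: cvg_id|apply: cvgD; [exact: cvg_cst|exact: cvg_id]].
Qed.

Theorem lemma3 (R : realType) (a tau : nat -> nat) (gamma : R) (T : nat)
    (a0 : a 0%N = 0%N)
    (a_incr : forall i : nat, (a i < a i.+1)%N)
    (tauP : is_delay a tau)
    (gamma_ge1 : 1 <= gamma)
    (durationP : forall i : nat,
       gamma^-1 * (duration a i)%:R <= (duration a i.+1)%:R
         <= gamma * (duration a i)%:R)
    (T_ge1 : (1 <= T)%N) :
  [/\ forall k i : nat, (k < T)%N -> (a 1%N <= k)%N -> in_job a i k ->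
        [/\ (overlap tau T k)%:R
              <= (duration a i)%:R + (duration a i.+1)%:R - 1 :> R,
            (duration a i)%:R + (duration a i.+1)%:R - 1
              <= (1 + gamma) * (duration a i)%:R
          & (1 + gamma) * (duration a i)%:R
              <= gamma * (1 + gamma) * (tau k)%:R],
      forall k : nat, (k < T)%N -> (a 1%N <= k)%N ->
        (overlap tau T k)%:R <= C_ov gamma * (tau k)%:R
    & C_ov g @[g --> (1 : R)] --> (2 : R)].
Proof.
have gamma_ge0 : 0 <= gamma by apply: le_trans gamma_ge1.
have chain k i : (k < T)%N -> (a 1%N <= k)%N -> in_job a i k ->
    [/\ (overlap tau T k)%:R
          <= (duration a i)%:R + (duration a i.+1)%:R - 1 :> R,
        (duration a i)%:R + (duration a i.+1)%:R - 1
          <= (1 + gamma) * (duration a i)%:R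
      & (1 + gamma) * (duration a i)%:R
          <= gamma * (1 + gamma) * (tau k)%:R].
  move=> _ a1k ik; split.
  - by rewrite lerBrDr natr1 -natrD ler_nat overlap_le.
  - by have /andP[_ ] := durationP i; rewrite mulrDl mul1r; lra.
  - case: i ik => [/(in_job_gt0 _ _ _ a1k)//|i] ik.
    rewrite (mulrC gamma) -mulrA ler_wpM2l ?addr_ge0//.
    have /andP[_ /le_trans->//] := durationP i.
    by rewrite ler_wpM2l// ler_nat (duration_le_delay a tau tauP).
split; [exact: chain| |exact: cvg_C_ov].
move=> k kT a1k; have [i ik] := in_job_exists a a_incr k a0.
by have [h1 h2 h3] := chain k i kT a1k ik; apply: le_trans (le_trans h1 h2) h3.
Qed.
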